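(* Let $X$ be a compact Hausdorff space without isolated points whose pointless part is $C^*$-embedded, meaning that its topology $L=\mathcal{O}X$ is isomorphic to $\beta\pi L$. Then the removal of any single point does not change $\mathcal{C}X$, in the sense that for any $x\in X$, $\mathcal{C}X=\mathcal{C}^*(X\setminus\{x\})$ (via restriction of functions).
   Context: $\mathcal{C}X$ is the set of continuous real-valued functions on $X$ and $\mathcal{C}^*Y$ the set of bounded continuous real-valued functions on $Y$. For a completely regular frame $L$, an element $c$ is a successor of $a$ if $c>a$ and there is no $b$ with $a<b<c$. The pointless part of $L$ is the sublocale $\pi L=\{a\in L:a\text{ has no successor}\}$, with quotient map $\pi_L:L\to\pi L$, $\pi_L(b)=\bigwedge\{a\in\pi L:a\ge b\}$. $\beta_M:\beta M\to M$ is the compact (Čech--Stone) coreflection of a completely regular frame $M$. That $L$ is isomorphic to $\beta\pi L$ is understood to mean that the map $\pi_L:L\to\pi L$ is isomorphic to $\beta_{\pi L}:\beta\pi L\to\pi L$, i.e., there is a frame isomorphism $h:L\to\beta\pi L$ with $\beta_{\pi L}\circ h=\pi_L$. *)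

(* Defs.v *)
From HB Require Import structures.
From mathcomp Require Import all_boot all_order all_algebra.
From mathcomp Require Import all_classical all_reals all_analysis.

Set Implicit Arguments.
Unset Strict Implicit.
Unset Printing Implicit Defensive.

Import Order.TTheory GRing.Theory Num.Theory.
Import numFieldNormedType.Exports.

Local Open Scope classical_set_scope.
Local Open Scope ring_scope.

(* The order notations for meet and join clash with those of classical sets,  *)
(* hence the prefix forms Order.meet and Order.join.                          *)

HB.mixin Record TBDistrLattice_isFrame d T of Order.TBDistrLattice d T := {
  frame_sup : set T -> T;
  frame_sup_isLub : forall A : set T, isLub A (frame_sup A);
  meet_frame_sup : forall (x : T) (A : set T),
    Order.meet x (frame_sup A) = frame_sup [set Order.meet x a | a in A]
}.

#[short(type="frameType")]
HB.structure Definition Frame d :=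
  { T of TBDistrLattice_isFrame d T & Order.TBDistrLattice d T }.

HB.factory Record POrder_isFrame d T of Order.POrder d T := {
  top : T;
  meet : T -> T -> T;
  sup : set T -> T;
  lex1 : forall x : T, (x <= top)%O;
  lexI : forall x y z : T, (x <= meet y z)%O = (x <= y)%O && (x <= z)%O;
  sup_isLub : forall A : set T, isLub A (sup A);
  le_meet_sup : forall (x : T) (A : set T),
    (meet x (sup A) <= sup [set meet x a | a in A])%O
}.

HB.builders Context d T of POrder_isFrame d T.

Let bot_le x : (sup set0 <= x)%O.
Proof. by apply: (sup_isLub set0).2 => ?. Qed.

Let leUx x y z : (sup [set x; y] <= z)%O = (x <= z)%O && (y <= z)%O.
Proof.
have [ub least] := sup_isLub [set x; y].
apply/idP/andP => [le_z|[xz yz]].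
  by split; apply: le_trans le_z; apply: ub; [left|right].
by apply: least => t [->|->].
Qed.

HB.instance Definition _ := Order.POrder_MeetJoin_isLattice.Build d T lexI leUx.
HB.instance Definition _ := Order.hasBottom.Build d T bot_le.
HB.instance Definition _ := Order.hasTop.Build d T lex1.

Let meet_sup x (A : set T) :
  Order.meet x (sup A) = sup [set Order.meet x a | a in A].
Proof.
apply/le_anti/andP; split; first exact: le_meet_sup.
apply: (sup_isLub _).2 => _ [a Aa <-].
by rewrite leI2 //; apply: (sup_isLub A).1.
Qed.

Let meetUl : @left_distributive T T Order.meet Order.join.
Proof.
move=> x y z; rewrite meetC [LHS]meet_sup image_setU !image_set1.
by rewrite ![Order.meet z _]meetC.
Qed.

HB.instance Definition _ := Order.Lattice_Meet_isDistrLattice.Build d T meetUl.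
HB.instance Definition _ :=
  TBDistrLattice_isFrame.Build d T sup_isLub meet_sup.

HB.end.

Section FrameTheory.
Context {d : Order.disp_t} {L : frameType d}.
Implicit Types (a b c x y : L) (A : set L).

Lemma frame_sup_ub A x : A x -> (x <= frame_sup A)%O.
Proof. exact: (frame_sup_isLub A).1. Qed.

Lemma frame_sup_least A x : ubound A x -> (frame_sup A <= x)%O.
Proof. exact: (frame_sup_isLub A).2. Qed.

Definition frame_inf A : L := frame_sup (lbound A).

Lemma frame_inf_lb A x : A x -> (frame_inf A <= x)%O.
Proof. by move=> Ax; apply: frame_sup_least => y; apply. Qed.

Lemma frame_inf_greatest A x : lbound A x -> (x <= frame_inf A)%O.
Proof. exact: frame_sup_ub. Qed.

Definition heyting a b : L := frame_sup [set z | (Order.meet a z <= b)%O].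

Lemma le_heyting a b z : (z <= heyting a b)%O = (Order.meet a z <= b)%O.
Proof.
apply/idP/idP => [zab|]; last exact: frame_sup_ub.
apply: (@le_trans _ _ (Order.meet a (heyting a b))); first by rewrite leI2.
by rewrite meet_frame_sup; apply: frame_sup_least => _ [w ? <-].
Qed.

Definition well_inside b a :=
  exists c, Order.meet b c = \bot%O /\ Order.join a c = \top%O.

(* The usual scale of elements, indexed by the rationals of [0, 1], between b *)
(* and a; the values of c outside [0, 1] are irrelevant.                      *)
Definition completely_below b a :=
  exists c : rat -> L, [/\ c 0 = b, c 1 = a &
    forall p q : rat, 0 <= p -> p < q -> q <= 1 -> well_inside (c p) (c q)].

Definition successor a c := (a < c)%O /\ ~ exists b, (a < b)%O /\ (b < c)%O.

End FrameTheory.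

Definition completely_regular_frame d (L : frameType d) :=
  forall a : L, a = frame_sup [set b | completely_below b a].

Definition compact_frame d (L : frameType d) :=
  forall A : set L, frame_sup A = \top%O ->
    exists B : set L, [/\ B `<=` A, finite_set B & frame_sup B = \top%O].

(* Preservation of the bottom is the case A = set0 of the last clause.        *)
Definition frame_hom d d' (L : frameType d) (M : frameType d') (f : L -> M) :=
  [/\ f \top%O = \top%O,
      forall a b, f (Order.meet a b) = Order.meet (f a) (f b) &
      forall A, f (frame_sup A) = frame_sup (f @` A)].

Definition frame_iso d d' (L : frameType d) (M : frameType d') (h : L -> M) :=
  frame_hom h /\ exists k : M -> L, [/\ frame_hom k, cancel h k & cancel k h].

(* beta : B -> M is the coreflection of M in the full subcategory of compact  *)
(* completely regular frames; this determines (B, beta) up to a unique        *)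
(* isomorphism over M.                                                        *)
Record compact_coreflection d d' (B : frameType d) (M : frameType d')
    (beta : B -> M) : Prop := {
  coreflection_compact : compact_frame B;
  coreflection_regular : completely_regular_frame B;
  coreflection_hom : frame_hom beta;
  coreflection_universal : forall (e : Order.disp_t) (K : frameType e),
    compact_frame K -> completely_regular_frame K ->
    forall f : K -> M, frame_hom f ->
    exists! g : K -> B, frame_hom g /\ beta \o g = f
}.

Definition opens (X : topologicalType) : Type := [set U : set X | open U].

Section Opens.
Context {X : topologicalType}.

HB.instance Definition _ := SubChoice.on (opens X).
HB.instance Definition _ :=
  [SubChoice_isSubPOrder of opens X by <: with set_display].

Definition mk_open (U : set X) (oU : open U) : opens X := exist _ U (mem_set oU).

Lemma open_val (U : opens X) : open (val U).
Proof. exact: set_mem (valP U). Qed.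

Lemma le_opens (U V : opens X) : (U <= V)%O <-> val U `<=` val V.
Proof. by rewrite -Order.le_val subsetEset. Qed.

Let top : opens X := mk_open openT.
Let meet (U V : opens X) : opens X := mk_open (openI (open_val U) (open_val V)).

Lemma open_bigcup_val (A : set (opens X)) : open (\bigcup_(U in A) val U).
Proof. by apply: bigcup_open => U _; exact: open_val. Qed.

Let sup (A : set (opens X)) : opens X := mk_open (open_bigcup_val A).

Let lex1 U : (U <= top)%O.
Proof. exact/le_opens. Qed.

Let lexI U V W : (U <= meet V W)%O = (U <= V)%O && (U <= W)%O.
Proof.
apply/idP/andP => [/le_opens UVW|[/le_opens UV /le_opens UW]].
  by split; apply/le_opens => x Ux; have [] := UVW x Ux.
by apply/le_opens => x Ux; split; [exact: UV|exact: UW].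
Qed.

Let sup_isLub A : isLub A (sup A).
Proof.
split=> [U AU|V ub]; apply/le_opens => /= x; first by exists U.
by case=> U AU; move: x; apply/le_opens/ub.
Qed.

Let le_meet_sup U A : (meet U (sup A) <= sup [set meet U V | V in A])%O.
Proof.
by apply/le_opens => x [/= Ux [V AV Vx]]; exists (meet U V); [exists V|split].
Qed.

HB.instance Definition _ := POrder_isFrame.Build set_display (opens X)
  lex1 lexI sup_isLub le_meet_sup.

End Opens.

Definition pointless_set d (L : frameType d) : set L :=
  [set a | ~ exists c, successor a c].
Arguments pointless_set {d} L.

Definition pointless_part d (L : frameType d) : Type := pointless_set L.

Section Pointless.
Context {d : Order.disp_t} {L : frameType d}.
Implicit Types (a b c e : L) (A : set L).

Lemma successor_join e c : successor (Order.meet e c) c ->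
  successor e (Order.join e c).
Proof.
move=> [ecc nec]; split.
  rewrite lt_neqAle leUl andbT; apply/eqP => eE.
  by move: ecc; rewrite lt_leAnge lexI lexx andbT eE leUr andbF.
move=> [b [eb bec]]; apply: nec; exists (Order.meet b c); split.
  rewrite lt_neqAle leI2 ?(ltW eb)// andbT; apply/eqP => E.
  have : b = e.
    by rewrite -(meet_l (ltW bec)) meetUr -E meet_r ?(ltW eb)// join_l// leIl.
  by move=> be; rewrite be ltxx in eb.
rewrite lt_neqAle leIr andbT; apply/eqP => bcE.
move: bec; rewrite lt_leAnge leUx (ltW eb) /= -[c in (c <= b)%O]bcE leIl.
by rewrite andbF.
Qed.

Lemma successor_meet e c : successor e (Order.join e c) ->
  successor (Order.meet e c) c.
Proof.
move=> [eec nec]; split.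
  rewrite lt_neqAle leIr andbT; apply/eqP => cE.
  by move: eec; rewrite lt_leAnge leUx lexx -cE leIl andbF.
move=> [b [ecb bc]]; apply: nec; exists (Order.join e b); split.
  rewrite lt_neqAle leUl andbT; apply/eqP => E.
  by move: ecb; rewrite lt_leAnge lexI (ltW bc) E leUr andbF.
rewrite lt_neqAle leU2 ?(ltW bc)// andbT; apply/eqP => E.
suff : (c <= b)%O by move: bc; rewrite lt_leAnge => /andP[_ /negP].
have -> : c = Order.meet c (Order.join e b) by rewrite E meet_l// leUr.
by rewrite meetUr leUx leIr andbT meetC ltW.
Qed.

Lemma pointless_setP a :
  (forall c, (a < c)%O ->
    exists2 e, pointless_set L e & (a <= e)%O /\ ~~ (c <= e)%O) ->
  pointless_set L a.
Proof.
move=> H [c sac]; have [ac nac] := sac; have [e Pe [ae nce]] := H c ac.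
apply: Pe; exists (Order.join e c); apply: successor_join.
have -> // : Order.meet e c = a.
apply: contrapT => /eqP ne; apply: nac; exists (Order.meet e c); split.
  by rewrite lt_neqAle eq_sym ne lexI ae ltW.
by rewrite lt_neqAle leIr andbT; apply: contra nce => /eqP <-; exact: leIl.
Qed.

Lemma pointless_inf A : A `<=` pointless_set L -> pointless_set L (frame_inf A).
Proof.
move=> PA; apply: pointless_setP => c; rewrite lt_leAnge => /andP[_ ncA].
apply: contrapT => H; move/negP: ncA; apply; apply: frame_inf_greatest => e Ae.
apply: contrapT => /negP nce; apply: H; exists e; first exact: PA.
by split; first exact: frame_inf_lb.
Qed.

Lemma pointless_heyting a e : pointless_set L e -> pointless_set L (heyting a e).
Proof.
move=> Pe [c stc]; have [tc ntc] := stc; set t := heyting a e in stc tc ntc.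
have et : (e <= t)%O by rewrite le_heyting leIr.
have at_e : (Order.meet a t <= e)%O by rewrite -le_heyting.
pose k := Order.meet a c.
have kc : Order.join t k = c.
  apply: contrapT => /eqP ne; apply: ntc; exists (Order.join t k); split.
    rewrite lt_neqAle leUl andbT; apply/eqP => tE.
    have : (k <= t)%O by rewrite tE leUr.
    rewrite le_heyting meetA meetxx -le_heyting -/t => ct.
    by move: tc; rewrite lt_leAnge ct andbF.
  by rewrite lt_neqAle ne leUx (ltW tc) leIr.
apply: Pe; exists (Order.join e k); apply: successor_join.
have -> : Order.meet e k = Order.meet t k.
  apply/le_anti; rewrite leI2//= lexI leIr andbT.
  by apply: le_trans at_e; rewrite lexI leIl andbT leIxr// leIl.
by apply: successor_meet; rewrite kc.
Qed.

HB.instance Definition _ := SubChoice.on (pointless_part L).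
HB.instance Definition _ :=
  [SubChoice_isSubPOrder of pointless_part L by <: with d].

Definition mk_pointless a (Pa : pointless_set L a) : pointless_part L :=
  exist _ a (mem_set Pa).

Lemma pointless_val (u : pointless_part L) : pointless_set L (val u).
Proof. exact: set_mem (valP u). Qed.
Arguments pointless_val : clear implicits.

(* The infimum is taken in L; it lies in the pointless part by                *)
(* pointless_inf.                                                             *)
Definition pointless_quo b : pointless_part L :=
  mk_pointless (@pointless_inf (pointless_set L `&` [set a | (b <= a)%O])
                  (@subIsetl _ _ _)).

Lemma pointless_quo_le b (u : pointless_part L) :
  (pointless_quo b <= u)%O = (b <= val u)%O.
Proof.
rewrite -Order.le_val; apply/idP/idP => [|bu].
  by apply: le_trans; apply: frame_inf_greatest => a [].
by apply: frame_inf_lb; split => //; exact: pointless_val.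
Qed.

Lemma pointless_top_subproof : pointless_set L \top%O.
Proof. by move=> [c [+ _]]; rewrite lt_leAnge lex1 andbF. Qed.

Let top : pointless_part L := mk_pointless pointless_top_subproof.

Lemma pointless_meet_subproof (u v : pointless_part L) :
  pointless_set L (Order.meet (val u) (val v)).
Proof.
have -> : Order.meet (val u) (val v) = frame_inf [set val u; val v].
  apply/le_anti/andP; split.
    by apply: frame_inf_greatest => _ [->|->]; [exact: leIl|exact: leIr].
  by rewrite lexI !frame_inf_lb//; [right|left].
by apply: pointless_inf => _ [->|->]; exact: pointless_val.
Qed.

Let meet u v : pointless_part L :=
  mk_pointless (@pointless_meet_subproof u v).

Let sup (A : set (pointless_part L)) : pointless_part L :=
  pointless_quo (frame_sup (val @` A)).

Let lex1 u : (u <= top)%O.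
Proof. by rewrite -Order.le_val lex1. Qed.

Let lexI u v w : (u <= meet v w)%O = (u <= v)%O && (u <= w)%O.
Proof. by rewrite -!Order.le_val lexI. Qed.

Let sup_isLub (A : set (pointless_part L)) : isLub A (sup A).
Proof.
split=> [u Au|v ub].
  have : (frame_sup (val @` A) <= val (sup A))%O by rewrite -pointless_quo_le.
  rewrite -Order.le_val; apply: le_trans.
  by apply: frame_sup_ub; exists u.
rewrite pointless_quo_le; apply: frame_sup_least => _ [u Au <-].
by rewrite Order.le_val; exact: ub.
Qed.

Let le_meet_sup u (A : set (pointless_part L)) :
  (meet u (sup A) <= sup [set meet u v | v in A])%O.
Proof.
set s := sup [set meet u v | v in A]; pose t := heyting (val u) (val s).
have Pt : pointless_set L t by apply: pointless_heyting; exact: pointless_val.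
have : (sup A <= mk_pointless Pt)%O.
  rewrite pointless_quo_le; apply: frame_sup_least => _ [v Av <-] /=.
  rewrite le_heyting; have : (meet u v <= s)%O.
    by apply: (sup_isLub [set meet u w | w in A]).1; exists v.
  by rewrite -Order.le_val.
rewrite -!Order.le_val -[val (mk_pointless Pt)]/t => supA.
by rewrite -[val (meet _ _)]/(Order.meet (val u) (val (sup A))) -le_heyting.
Qed.

HB.instance Definition _ := POrder_isFrame.Build d (pointless_part L)
  lex1 lexI sup_isLub le_meet_sup.

Lemma le_pointless_quo b : (b <= val (pointless_quo b))%O.
Proof. by rewrite -pointless_quo_le. Qed.

Lemma pointless_quo_homo a b :
  (a <= b)%O -> (pointless_quo a <= pointless_quo b)%O.
Proof. by move=> ab; rewrite pointless_quo_le (le_trans ab)// le_pointless_quo. Qed.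

Lemma pointless_quo_hom : frame_hom pointless_quo.
Proof.
split=> [|a b|A].
- by apply/le_anti; rewrite lex1 -Order.le_val le_pointless_quo.
- apply/le_anti/andP; split; first by rewrite lexI !pointless_quo_homo ?leIl ?leIr.
  set u := pointless_quo (Order.meet a b).
  have H x y (v : pointless_part L) : (Order.meet x y <= val v)%O ->
      (Order.meet x (val (pointless_quo y)) <= val v)%O.
    move=> xyv; have Pt := pointless_heyting (a := x) (pointless_val v).
    rewrite -le_heyting -[heyting _ _]/(val (mk_pointless Pt)) Order.le_val.
    by rewrite pointless_quo_le le_heyting.
  rewrite -Order.le_val -[val (Order.meet _ _)]/(Order.meet (val _) (val _)).
  by apply: (H); rewrite meetC; apply: (H); rewrite meetC le_pointless_quo.
- apply/le_anti/andP; split.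
    rewrite pointless_quo_le; apply: frame_sup_least => a Aa.
    by rewrite -pointless_quo_le; apply: frame_sup_ub; exists a.
  apply: frame_sup_least => _ [a Aa <-].
  by apply/pointless_quo_homo/frame_sup_ub.
Qed.

End Pointless.

Arguments pointless_quo {d} L b.

(* B ranges over all compact coreflections of the pointless part, which are   *)
(* isomorphic over it, so the choice of a particular one is immaterial.       *)
Definition pointless_part_Cstar_embedded d (L : frameType d) :=
  exists (d' : Order.disp_t) (B : frameType d') (beta : B -> pointless_part L),
    compact_coreflection beta /\
    exists h : L -> B, frame_iso h /\ beta \o h = pointless_quo L.

Definition C_set (R : realType) (X : topologicalType) : set (X -> R) :=
  [set f | continuous f].
Arguments C_set R X : clear implicits.

Definition Cstar_set (R : realType) (X : topologicalType) : set (X -> R) :=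
  [set f | continuous f /\ bounded_fun f].
Arguments Cstar_set R X : clear implicits.

(* Main.v *)
Require Import Defs.
From HB Require Import structures.
From mathcomp Require Import all_boot all_order all_algebra.
From mathcomp Require Import all_classical all_reals all_analysis.
Import numFieldNormedType.Exports.
Local Open Scope classical_set_scope.

(** Only surjectivity of the restriction needs an idea. Let f be a bounded
    continuous function on the complement U of x, with values in the interval
    K = [a, b], and write L for the frame of opens of X and pi for the quotient
    map onto its pointless part.

    Nothing lies strictly between U and X, so X is a successor of U, the only
    pointless open containing U is X, and pi U is the top element
    ([pointless_quo_setC1]). Hence V |-> pi (f^-1 V) preserves the top, and is
    a frame homomorphism from the opens of K to the pointless part
    ([subspace_preimage_quo_hom]). The interval K is compact Hausdorff, so its
    frame of opens is compact and completely regular ([compact_opens],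
    [completely_regular_opens]) and this homomorphism lifts along the compact
    coreflection, that is, along pi itself: there is a frame homomorphism
    from the opens of K to L that agrees with f^-1 after applying pi. As K is
    regular, that homomorphism is the preimage map of a continuous function
    F : X -> K ([frame_hom_continuous]).

    It remains to see that F extends f. If F u and f u had disjoint
    neighbourhoods V and W, the open set N = F^-1 V `&` f^-1 W would contain
    u, while pi N = pi (f^-1 V) `&` pi (f^-1 W) = pi (f^-1 (V `&` W)) would
    be pi applied to the empty set. Without isolated points the empty set has
    no successor ([pointless_bot]), so it is its own image under pi, and
    N <= pi N would be empty. *)

Set Implicit Arguments.
Unset Strict Implicit.
Unset Printing Implicit Defensive.
Import Order.TTheory GRing.Theory Num.Theory.
Local Open Scope ring_scope.

(** * Frame homomorphisms *)

Section FrameHom.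
Context {d d' : Order.disp_t} {L : frameType d} {M : frameType d'}.

Lemma frame_hom_comp d'' (N : frameType d'') (f : L -> M) (g : M -> N) :
  frame_hom f -> frame_hom g -> frame_hom (g \o f).
Proof.
move=> [f1 fI fS] [g1 gI gS]; split=> [|a b|A] /=.
- by rewrite f1 g1.
- by rewrite fI gI.
- by rewrite fS gS image_comp.
Qed.

Lemma frame_hom_bot (f : L -> M) : frame_hom f -> f \bot%O = \bot%O.
Proof.
move=> [_ _ fS]; have E e (N : frameType e) : frame_sup set0 = \bot%O :> N.
  by apply/le_anti; rewrite le0x frame_sup_least.
by rewrite -E fS image_set0 E.
Qed.

End FrameHom.

(** * The frame of open sets *)

Section OpensFrame.
Context {X : topologicalType}.
Implicit Types (U V : opens X) (A : set (opens X)).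

Lemma opens_inj U V : val U = val V -> U = V.
Proof. exact: val_inj. Qed.

Lemma val_opensI U V : val (Order.meet U V) = val U `&` val V.
Proof. by []. Qed.

Lemma val_opens_sup A : val (frame_sup A) = \bigcup_(U in A) val U.
Proof. by []. Qed.

Lemma val_opens0 : val (\bot%O : opens X) = set0.
Proof.
have /le_opens : (\bot%O <= mk_open (@open0 X))%O by rewrite le0x.
by rewrite subset0.
Qed.

(** The covers here are families indexed by themselves, so the finite subcover
    is read off near-coverings for the filter generated by the sets of
    subfamilies that contain a given finite one. *)
Lemma compact_opens : compact [set: X] -> compact_frame (opens X).
Proof.
move=> /compact_near_coveringP cX A A1.
pose F := [set Q : set (set (opens X)) | exists B0,
  [/\ B0 `<=` A, finite_set B0 &
    forall B, B0 `<=` B -> Q B]].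
have FF : Filter F.
  split; first by exists set0; split.
    move=> P Q [B [BA fB PB]] [C [CA fC QC]]; exists (B `|` C); split.
    - by rewrite subUset.
    - by rewrite finite_setU.
    - by move=> D; rewrite subUset => -[BD CD]; split; [exact: PB|exact: QC].
  move=> P Q PQ [B [BA fB PB]]; exists B; split=> // C BC.
  exact/PQ/PB.
have /(_ FF)[y _|B [BA fB BX]] :=
    cX _ F (fun (B : set (opens X)) y => exists2 V, B V & val V y).
  have : val (frame_sup A) y by rewrite A1.
  case=> U AU Uy; exists (val U, [set B | B U]) => /=.
    split; first exact: (open_nbhs_nbhs (conj (open_val U) Uy)).
    exists [set U]; split; [by move=> _ ->|exact: finite_set1|].
    by move=> B; apply.
  by case=> /= z B [Uz BU]; exists U.
exists B; split=> //; apply/opens_inj; rewrite val_opens_sup -subTset => y _.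
by have [V BV Vy] := BX B (@subset_refl _ B) y I; exists V.
Qed.

Lemma well_inside_opens U V :
  closure (val U) `<=` val V -> well_inside U V.
Proof.
move=> UV; have oC : open (~` closure (val U)).
  exact/closed_openC/closed_closure.
exists (mk_open oC); split; apply/opens_inj.
  rewrite val_opens0 val_opensI -subset0 => y [Uy]; apply.
  exact: subset_closure.
rewrite -subTset => y _.
have [/UV Vy|nUy] := pselect (closure (val U) y).
  by have /le_opens := leUl V (mk_open oC); exact.
by have /le_opens := leUr (mk_open oC) V; exact.
Qed.

Lemma open_sublevel (R : realType) (f : X -> R) (s : R) :
  continuous f -> open (f @^-1` [set r | r < s]).
Proof. by move=> /continuousP cf; apply/cf/open_lt. Qed.

(** These sets form the scales that witness complete regularity. *)
Definition sublevel (R : realType) (f : X -> R) (cf : continuous f) (s : R) :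
  opens X := mk_open (open_sublevel s cf).

Lemma closure_sublevel (R : realType) (f : X -> R) (s : R) :
  continuous f -> closure [set y | f y < s] `<=` [set y | f y <= s].
Proof.
move=> /continuous_closedP cf.
have cl : closed (f @^-1` [set r : R | r <= s]) by apply: cf; exact: closed_le.
rewrite [X in _ `<=` X](closure_id _).1//; apply: closure_subset => y /=.
exact: ltW.
Qed.

(** The scale consists of the sublevel sets at the levels interpolating
    linearly between s and t; the closure of each lies in the next one, as its
    points satisfy the non-strict inequality. The top of the scale has to be U
    exactly, hence the case distinction in the witness. *)
Lemma sublevel_completely_below (R : realType) (f : X -> R)
    (cf : continuous f) (s t : R) U : s < t -> [set y | f y < t] `<=` val U ->
  completely_below (sublevel cf s) U.
Proof.
move=> st ftU.
pose l (p : rat) : R := s + ratr p * (t - s).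
have lP p q : p < q -> l p < l q.
  by move=> pq; rewrite ltrD2l ltr_pM2r ?subr_gt0// ltr_rat.
have l1 : l 1 = t by rewrite /l rmorph1 mul1r addrC subrK.
exists (fun p => if p < 1 then sublevel cf (l p) else U); split.
- by rewrite ltr01 /l rmorph0 mul0r addr0.
- by rewrite ltxx.
- move=> p q p0 pq q1; rewrite (lt_le_trans pq q1).
  apply: well_inside_opens; apply: subset_trans (closure_sublevel cf) _.
  case: ifPn => [q1'|_] y /= fy; first by rewrite /= (le_lt_trans fy)// lP.
  by apply: ftU; rewrite /= -l1 (le_lt_trans fy)// lP// (lt_le_trans pq).
Qed.

(** A function that is 0 at y and 1 off U gives the element
    [sublevel cf 2^-1], which contains y and is completely below U. *)
Lemma completely_regular_opens (R : realType) :
  completely_regular_space X -> completely_regular_frame (opens X).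
Proof.
move=> crX U; apply/le_anti/andP; split; last first.
  (* An element well inside U is below U, by distributivity. *)
  apply: frame_sup_least => V [c [c0 c1 /(_ 0 1)]].
  rewrite lexx ltr01 lexx c0 c1 => /(_ isT isT isT)[W [VW UW]].
  by rewrite -[V]meetx1 -UW meetUr VW joinx0 leIr.
apply/le_opens => y Uy.
have /(uniform_separatorP (R := R))[f [cf _ f0 f1]] :
    uniform_separator [set y] (~` val U).
  by apply: crX; [exact/open_closedC/open_val|exact].
rewrite val_opens_sup; exists (sublevel cf 2^-1).
  apply: (@sublevel_completely_below _ _ _ _ 1).
    by rewrite invf_lt1// ltr1n.
  move=> z /=; apply: contraPP => nUz.
  have -> : f z = 1 by apply: f1; exists z.
  by rewrite ltxx.
have -> : val (sublevel cf 2^-1) y = (f y < 2^-1) by [].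
have -> : f y = 0 by apply: f0; exists y.
by rewrite invr_gt0.
Qed.

End OpensFrame.

(** * Frame homomorphisms into the opens of a space *)

Section FrameHomPoints.
Context {X K : topologicalType} (g : opens K -> opens X).
Hypotheses (regK : regular_space K) (gP : frame_hom g).

(** Otherwise the opens V with y outside g V would cover K, and y would lie in
    g K = X without lying in any of the sets g V whose union this is. *)
Lemma frame_hom_point y :
  exists k, forall V : opens K, val V k -> val (g V) y.
Proof.
have [g1 _ gS] := gP.
apply: contrapT => /forallNP H.
have : val (g (frame_sup [set V | ~ val (g V) y])) y.
  suff -> : frame_sup [set V | ~ val (g V) y] = \top%O by rewrite g1.
  apply/opens_inj; rewrite -subTset => k _.
  have /existsNP[V /not_implyP[Vk nVy]] := H k.
  by exists V.
by rewrite gS => -[_ [V + <-]]; apply.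
Qed.

(** F y is any point provided by [frame_hom_point], which gives one inclusion.
    For the other, regularity makes V the union of the opens W whose closure
    lies in V. If y is in g W then F y is in the closure of W: otherwise y
    would also be in the image under g of the complement C of this closure,
    whereas g W and g C are disjoint. *)
Lemma frame_hom_continuous :
  exists2 F : X -> K, continuous F & forall V, F @^-1` val V = val (g V).
Proof.
have [F HF] := choice frame_hom_point.
have [g1 gI gS] := gP.
have FE V : F @^-1` val V = val (g V).
  apply/seteqP; split=> [y|y gVy]; first exact: HF.
  have VE : V = frame_sup [set W : opens K | closure (val W) `<=` val V].
    apply/opens_inj/seteqP; split=> [k Vk|k [W WV Wk]]; last first.
      exact/WV/subset_closure.
    have [C kC CV] := regK (open_nbhs_nbhs (conj (open_val V) Vk)).
    exists (mk_open (@open_interior _ C)); last by [].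
    by apply: subset_trans CV; apply: closure_subset; exact: interior_subset.
  move: gVy; rewrite {1}VE gS => -[_ [W WV <-] gWy].
  apply: WV; apply: contrapT => nWF.
  have oC : open (~` closure (val W)) by exact/closed_openC/closed_closure.
  have : val (g (Order.meet W (mk_open oC))) y.
    by rewrite gI; split=> //; exact: HF.
  have -> : Order.meet W (mk_open oC) = \bot%O.
    apply/opens_inj; rewrite val_opens0 -subset0 => k [Wk]; apply.
    exact: subset_closure.
  by rewrite (frame_hom_bot gP) val_opens0.
exists F => //; apply/continuousP => V oV.
by rewrite -[V]/(val (mk_open oV)) FE; exact: open_val.
Qed.

End FrameHomPoints.

(** * Separation and subspaces *)

Lemma hausdorff_separate (X : topologicalType) (p q : X) :
  hausdorff_space X -> p <> q ->
  exists V W, [/\ open V, open W, V p, W q & V `&` W = set0].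
Proof.
rewrite open_hausdorff => hX /eqP /hX[[V W]] /= [].
rewrite !inE => Vp Wq [oV oW VW].
by exists V, W; split=> //; apply/eqP.
Qed.

Section SetTypeTopology.
Context {X : topologicalType} (A : set X).

Lemma continuous_set_val : continuous (set_val : A -> X).
Proof. by apply/continuousP => V oV; exists V. Qed.

Lemma hausdorff_set_type : hausdorff_space X -> hausdorff_space A.
Proof.
move=> hX p q pq; apply/val_inj/hX => V W Vp Wq.
have [r [Vr Wr]] := pq _ _ (continuous_set_val Vp) (continuous_set_val Wq).
by exists (set_val r).
Qed.

Lemma compact_set_type : compact A -> compact [set: A].
Proof.
move=> cA F FF _; have [|p [Ap clp]] := cA (set_val @ F).
  have -> : (set_val @ F) A = F setT.
    by congr F; rewrite -subTset => u _; exact: set_valP.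
  exact: filterT.
exists (exist _ p (mem_set Ap)); split=> // B V FB [_ [[W oW <-] Wp WV]].
have [_ [[u Bu <-] Wu]] : set_val @` B `&` W !=set0.
  apply: clp; last exact: (open_nbhs_nbhs (conj oW Wp)).
  suff : F (set_val @^-1` (set_val @` B)) by [].
  by apply: filterS FB => u Bu; exists u.
by exists u; split=> //; exact: WV.
Qed.

End SetTypeTopology.

(** * The pointless part of the frame of opens *)

Section PointlessOpens.
Context {X : topologicalType}.

(** The complement of x is not pointless, X being its successor; so the least
    pointless open containing it contains x. *)
Lemma pointless_quo_setC1 (U : opens X) x :
  val U = [set~ x] -> pointless_quo (opens X) U = \top%O.
Proof.
move=> UE; apply/val_inj; apply: contrapT => ne.
set V := (X in X = _) in ne.
have UV : (U <= V)%O by exact: le_pointless_quo.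
have nVx : ~ val V x.
  move=> Vx; apply: ne; apply/opens_inj; rewrite -subTset => y _.
  have [->//|yx] := pselect (y = x).
  by move/le_opens: UV; apply; rewrite UE.
have UVE : V = U.
  apply/le_anti; rewrite UV andbT; apply/le_opens => y Vy; rewrite UE => yx.
  by apply: nVx; rewrite -yx.
have : pointless_set (opens X) V by exact: pointless_val.
apply; exists \top%O; split; first by rewrite ltx1; exact/eqP.
move=> [W []]; rewrite UVE !lt_leAnge => /andP[UW /negP nWU] /andP[_ /negP].
apply.
apply/le_opens => y _; have [->|yx] := pselect (y = x); last first.
  by move/le_opens: UW; apply; rewrite UE.
apply: contrapT => nWx; apply: nWU; apply/le_opens => z Wz; rewrite UE => zx.
by apply: nWx; rewrite -zx.
Qed.

Hypotheses (accX : accessible_space X) (noisoX : isolated [set: X] = set0).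

Lemma not_isolated (p : X) : ~ open [set p].
Proof.
move=> op; have : isolated [set: X] p; last by rewrite noisoX.
split; first by rewrite in_setT.
exists [set p]; last by rewrite setIT.
exact: open_nbhs_nbhs.
Qed.

(** A successor V of the empty set is a single point p: otherwise removing p
    from V leaves an open set strictly between. Such a point is isolated. *)
Lemma pointless_bot : pointless_set (opens X) \bot%O.
Proof.
move=> [V [V0 nV]].
have [p Vp] : val V !=set0.
  apply/set0P; apply: contra_ltN V0 => /eqP V0.
  by apply/le_opens; rewrite V0.
have oVp : open (val V `&` ~` [set p]).
  by apply: openI; [exact: open_val|exact/closed_openC/accessible_closed_set1].
have [E|/eqP ne] := eqVneq (mk_open oVp) \bot%O.
  apply: (@not_isolated p); have -> : [set p] = val V; last exact: open_val.
  apply/seteqP; split=> [_ ->//|q Vq]; apply: contrapT => qp.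
  have : val (mk_open oVp) q by split.
  by rewrite E val_opens0.
apply: nV; exists (mk_open oVp); split; first by rewrite lt0x; apply/eqP.
rewrite lt_leAnge; apply/andP; split; first by apply/le_opens => q [].
by apply/negP => /le_opens /(_ p Vp)[_]; apply.
Qed.

Lemma pointless_quo_bot : val (pointless_quo (opens X) \bot%O) = \bot%O.
Proof.
apply/le_anti; rewrite le0x andbT.
by rewrite -[leRHS]/(val (mk_pointless pointless_bot)) Order.le_val
  pointless_quo_le.
Qed.

End PointlessOpens.

(** * Extending continuous maps from an open subspace *)

Section SubspaceOpen.
Context {X K : topologicalType} (U : set X) (oU : open U) (f : U -> K).
Hypothesis cf : continuous f.

Lemma open_subspace_preimage (V : opens K) : open (set_val @` (f @^-1` val V)).
Proof.
move/continuousP: cf => /(_ _ (open_val V))[W oW WE]; rewrite -WE.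
have -> : set_val @` (set_val @^-1` W : set U) = U `&` W.
  apply/seteqP; split=> [_ [u Wu <-]|y [Uy Wy]].
    by split=> //; exact: set_valP.
  by exists (exist _ y (mem_set Uy)).
exact: openI.
Qed.

Definition subspace_preimage (V : opens K) : opens X :=
  mk_open (open_subspace_preimage V).

(** The preimage map itself sends the top to U, so it becomes a frame
    homomorphism only after a quotient that identifies U with X. *)
Lemma subspace_preimage_quo_hom :
  pointless_quo (opens X) (mk_open oU) = \top%O ->
  frame_hom (pointless_quo (opens X) \o subspace_preimage).
Proof.
have [_ qI qS] := @pointless_quo_hom _ (opens X).
move=> qU; split=> [|V W|A] /=.
- rewrite -qU; congr (pointless_quo _ _); apply/opens_inj/seteqP.
  split=> [_ [u _ <-]|y Uy]; first exact: set_valP.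
  by exists (exist _ y (mem_set Uy)).
- rewrite -qI; congr (pointless_quo _ _); apply/opens_inj/seteqP.
  split=> [_ [u [Vu Wu] <-]|y [[u Vu <-] [v Wv vu]]].
    by split; exists u.
  by exists u => //; split=> //; have -> : u = v by exact/val_inj.
- rewrite -(image_comp subspace_preimage (pointless_quo (opens X))) -qS.
  congr (pointless_quo _ _); apply/opens_inj/seteqP.
  split=> [_ [u [V AV Vu] <-]|y [_ [V AV <-] [u Vu <-]]].
    by exists (subspace_preimage V); [exists V|exists u].
  by exists u => //; exists V.
Qed.

End SubspaceOpen.

Arguments subspace_preimage {X K U} oU {f} cf V.

(** The map pi is dense: an open set with the same image as the empty set is
    empty. Two maps into a Hausdorff space whose preimage maps agree after
    applying pi therefore cannot differ at a point. The Urysohn functions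
    that make K completely regular take their values in R. *)
Lemma Cstar_embedded_extension (R : realType) (X K : topologicalType)
    (U : set X) (oU : open U) (f : U -> K) :
  hausdorff_space X -> isolated [set: X] = set0 ->
  pointless_part_Cstar_embedded (opens X) ->
  pointless_quo (opens X) (mk_open oU) = \top%O ->
  compact [set: K] -> hausdorff_space K -> continuous f ->
  exists2 F : X -> K, continuous F & F \o set_val = f.
Proof.
move=> hX nX [d [B [beta [coB [h [[_ [k [kP hk kh]]] hE]]]]]] qU cK hK cf.
have crK : completely_regular_space K.
  apply: (@normal_completely_regular R K); first exact: compact_normal.
  exact: hausdorff_accessible.
have [g [[gP gE] _]] := coreflection_universal coB (compact_opens cK)
  (completely_regular_opens R crK) (subspace_preimage_quo_hom cf qU).
(* k is the inverse of h, so k \o g lifts the homomorphism along pi. *)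
have qkg V : pointless_quo (opens X) (k (g V)) =
    pointless_quo (opens X) (subspace_preimage oU cf V).
  by rewrite -[RHS]/((_ \o subspace_preimage oU cf) V) -gE -hE /= kh.
have [F cF FE] :=
  frame_hom_continuous (@completely_regular_regular R K crK)
    (frame_hom_comp gP kP).
exists F => //; apply/funext => u /=; apply: contrapT => Fu.
have [V [W [oV oW VF Wf VW]]] := hausdorff_separate hK Fu.
pose N :=
  Order.meet (k (g (mk_open oV))) (subspace_preimage oU cf (mk_open oW)).
have : val N (set_val u).
  split; last by exists u.
  by rewrite -[k (g _)]/((k \o g) _) -FE.
have [_ qI _] := @pointless_quo_hom _ (opens X).
have [_ SI _] := subspace_preimage_quo_hom cf qU.
have N0 : (N <= \bot)%O.
  rewrite -(pointless_quo_bot (hausdorff_accessible hX) nX).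
  rewrite -pointless_quo_le qI qkg -[X in (X <= _)%O]SI /=.
  apply: pointless_quo_homo; apply/le_opens => z [v VWv _].
  by have : (V `&` W) (f v) by []; rewrite VW.
by move/le_opens: N0 => /[apply]; rewrite val_opens0.
Qed.

(** * Removing a point *)

Theorem proposition8p3p1 (R : realType) (X : topologicalType)
    (cX : compact [set: X]) (hX : hausdorff_space X)
    (noisoX : isolated [set: X] = set0)
    (embX : pointless_part_Cstar_embedded (opens X)) (x : X) :
  set_bij (C_set R X) (Cstar_set R [set~ x])
    (fun f : X -> R => f \o (set_val : [set~ x] -> X)).
Proof.
have ox : open [set~ x].
  exact/closed_openC/accessible_closed_set1/hausdorff_accessible.
split.
- move=> f cf; split.
    by move=> u; apply: continuous_comp; [exact: continuous_set_val|exact: cf].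
  have : bounded_set (f @` setT).
    apply: compact_bounded; apply: continuous_compact => //.
    exact: continuous_subspaceT.
  move=> [M [Mr fM]]; exists M; split=> // N MN u _ /=.
  by apply: (fM N MN); exists (set_val u).
- (* If f x and g x differed, x would be the only point of an open set: at any
     other point f and g agree, so they cannot take values in disjoint sets. *)
  move=> f g; rewrite !inE => cf cg fg; apply/funext => y.
  have [->{y}|yx] := pselect (y = x); last first.
    exact: (congr1 (fun h => h (exist _ y (mem_set yx))) fg).
  apply: contrapT => ne.
  have [V [W [oV oW Vf Wg VW]]] := hausdorff_separate (@Rhausdorff R) ne.
  apply: (@not_isolated _ noisoX x).
  have -> : [set x] = f @^-1` V `&` g @^-1` W.
    apply/seteqP; split=> [_ ->//|y [Vy Wy]]; apply: contrapT => yx.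
    have fgy : f y = g y.
      exact: (congr1 (fun h => h (exist _ y (mem_set yx))) fg).
    by have : (V `&` W) (f y) by [split=> //; rewrite fgy]; rewrite VW.
  by apply: openI; [apply: (continuousP _).1 oV|apply: (continuousP _).1 oW].
- move=> f [cf [M [Mr fM]]].
  (* M bounds f only through all larger numbers, whence the M + 1. *)
  have fI u : f u \in (`[- (M + 1), M + 1]%classic : set R).
    by rewrite inE /= in_itv /= -ler_norml; apply: fM => //; rewrite ltrDl.
  pose f' (u : [set~ x]) : (`[- (M + 1), M + 1]%classic : set R) :=
    exist _ (f u) (fI u).
  have cf' : continuous f' by apply: continuous_comp_initial.
  have [F cF FE] := Cstar_embedded_extension R hX noisoX embX
    (pointless_quo_setC1 (U := mk_open ox) erefl)
    (compact_set_type (@segment_compact _ _ _))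
    (hausdorff_set_type (@Rhausdorff R)) cf'.
  exists (set_val \o F).
    by move=> y; apply: continuous_comp; [exact: cF|exact: continuous_set_val].
  by rewrite -compA FE.
Qed.
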